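(* Let $k=3$ and let $A_n,\bar A_n$ ($n\ge1$) be the antiregular $3$-hypergraphs defined in the context. Then for every $n\ge 1$ the independence polynomials $I(A_n;x)$ and $I(\bar A_n;x)$ are log-concave.
   Context: All hypergraphs are $3$-uniform. For a binary string $b=b_1\cdots b_n$, let $H(b)$ be the $3$-uniform hypergraph on $\{1,\dots,n\}$ in which a $3$-subset is a hyperedge iff its largest element $j$ satisfies $b_j=1$. For $n\le 2$, $A_n=\bar A_n$ is the edgeless hypergraph on $n$ vertices; for $n\ge 3$, $A_n=H(b)$ with $b$ of length $n$, $b_1=b_2=0$, $b_3,\dots,b_n$ alternating and $b_n=1$, and $\bar A_n$ is the same with $b_n=0$. A vertex set is independent if it contains no hyperedge, and $I(H;x)=\sum_{W\text{ independent}}x^{|W|}$. A polynomial $\sum_{i=0}^m a_ix^i$ of degree $m$ is log-concave if $a_i^2\ge a_{i-1}a_{i+1}$ for all $1\le i\le m-1$. *)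

(* Defs.v *)
From mathcomp Require Import all_boot all_order all_algebra.

Set Implicit Arguments.
Unset Strict Implicit.
Unset Printing Implicit Defensive.

Import GRing.Theory Num.Theory.
Local Open Scope ring_scope.

(* A hypergraph on a finite vertex type T is given by its set of hyperedges.
   Vertices and string positions are numbered from 0: the vertex j and the
   bit b_j of the mathematical text are here j - 1 and tnth b (j - 1). *)

Definition hypergraph (T : finType) := {set {set T}}.

Definition uniform (T : finType) (k : nat) (E : hypergraph T) : bool :=
  [forall e in E, #|e| == k].

Definition string_hypergraph (n : nat) (b : n.-tuple bool) : hypergraph 'I_n :=
  [set e : {set 'I_n} |
    (#|e| == 3)%N &&
    [exists j : 'I_n, [&& j \in e, [forall i in e, (i <= j)%N] & tnth b j]]].

(* The string 0 0 b_3 ... b_n with b_3, ..., b_n alternating and b_n = c. *)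
Definition antiregular_string (n : nat) (c : bool) : n.-tuple bool :=
  [tuple (1 < i)%N && (c (+) odd (n.-1 - i)) | i < n].

Definition antiregular (n : nat) : hypergraph 'I_n :=
  if (n <= 2)%N then set0 else string_hypergraph (antiregular_string n true).

Definition antiregular_bar (n : nat) : hypergraph 'I_n :=
  if (n <= 2)%N then set0 else string_hypergraph (antiregular_string n false).

Definition independent (T : finType) (E : hypergraph T) (W : {set T}) : bool :=
  [forall e in E, ~~ (e \subset W)].

Definition indep_poly (T : finType) (E : hypergraph T) : {poly int} :=
  \sum_(W : {set T} | independent E W) 'X^#|W|.

(* The degree of p is (size p).-1. *)
Definition log_concave (p : {poly int}) : Prop :=
  forall i : nat, (1 <= i)%N -> (i < (size p).-1)%N ->
    p`_i.-1 * p`_i.+1 <= p`_i ^+ 2.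

Lemma string_hypergraph_uniform (n : nat) (b : n.-tuple bool) :
  uniform 3 (string_hypergraph b).
Proof. by apply/forall_inP => e; rewrite inE => /andP[]. Qed.

Lemma antiregular_string_init (n : nat) (c : bool) (i : 'I_n) :
  (i < 2)%N -> tnth (antiregular_string n c) i = false.
Proof. by rewrite tnth_mktuple ltnNge -ltnS; case: ltnP. Qed.

Lemma antiregular_string_alternating (n : nat) (c : bool) (i j : 'I_n) :
  (2 <= i)%N -> j = i.+1 :> nat ->
  tnth (antiregular_string n c) j = ~~ tnth (antiregular_string n c) i.
Proof.
move=> i2 ji; have := ltn_ord j; rewrite !tnth_mktuple ji i2 (leqW i2) /=.
move=> lin; have lin' : (i < n.-1)%N by rewrite -ltnS (ltn_predK lin).
by rewrite -(subnSK lin') /= addbN negbK.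
Qed.

Lemma antiregular_string_last (n : nat) (c : bool) (i : 'I_n) :
  (3 <= n)%N -> i = n.-1 :> nat -> tnth (antiregular_string n c) i = c.
Proof.
move=> n3 ni; rewrite tnth_mktuple ni subnn addbF.
by rewrite -ltnS (ltn_predK n3) n3.
Qed.

(* Main.v *)
(** Deleting the last vertex gives I(A_n) = I(bar A_(n-1)) + x + (n-1) x^2 and
    I(bar A_n) = (1+x) I(A_(n-1)), hence the two-step recurrence
    I(A_n) = (1+x) I(A_(n-2)) + x + (n-1) x^2.  Multiplication by 1+x preserves
    log-concavity of nonnegative sequences without internal zeros, and the
    correction term only touches the coefficients of x and x^2.  So only the
    inequalities at i <= 3 are new, and they follow from closed forms of the
    first five coefficients. *)

Require Import Defs.
From mathcomp Require Import all_boot all_order all_algebra.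
From mathcomp Require Import zify ring.

Set Implicit Arguments.
Unset Strict Implicit.
Unset Printing Implicit Defensive.

Import Order.TTheory GRing.Theory Num.Theory.
Local Open Scope ring_scope.

(** * Independence in string hypergraphs *)

(** A hyperedge inside [W] with largest element [j] is [j] plus two smaller elements of [W], so
    independence becomes a count at each vertex with bit 1. *)
Lemma independent_stringE (n : nat) (b : n.-tuple bool) (W : {set 'I_n}) :
  independent (string_hypergraph b) W =
  [forall j in W, tnth b j ==> (#|[set i in W | (i < j)%N]| < 2)%N].
Proof.
apply/forall_inP/forall_inP => [indW j jW | lowW e].
  apply/implyP => bj; rewrite ltnNge; apply/negP => /card_gt1P[x [y []]].
  rewrite !inE => /andP[xW xj] /andP[yW yj] xy.
  suff /indW /negP[]: j |: [set x; y] \in string_hypergraph b.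
    by apply/subsetP => z; rewrite !inE => /or3P[] /eqP->.
  rewrite inE; apply/andP; split.
    rewrite cardsU1 cards2 !inE xy negb_or.
    have [-> -> //] : j != x /\ j != y.
    by split; apply/eqP => ej; move: xj yj; rewrite -ej ltnn.
  apply/existsP; exists j; rewrite !inE eqxx bj andbT /=.
  by apply/forall_inP => z; rewrite !inE => /or3P[] /eqP-> //; apply: ltnW.
rewrite inE => /andP[/eqP e3 /existsP[j /and3P[je /forall_inP jmax bj]]].
apply/negP => /subsetP eW.
have := implyP (lowW j (eW _ je)) bj.
apply/negP; rewrite -leqNgt.
have <- : #|e :\ j| = 2%N by move: e3; rewrite (cardsD1 j) je => -[].
apply/subset_leq_card/subsetP => i; rewrite !inE => /andP[ij ie].
by rewrite eW //= ltn_neqAle jmax // andbT.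
Qed.

(** * Deleting the last vertex *)

Section LastVertex.

Variables (n : nat) (b : n.+1.-tuple bool) (b' : n.-tuple bool).
Hypothesis eq_b : forall i : 'I_n, tnth b' i = tnth b (lift ord_max i).

Let f : 'I_n -> 'I_n.+1 := lift ord_max.
Let f_inj : injective f := @lift_inj _ ord_max.

Let max_f (U : {set 'I_n}) : ord_max \notin f @: U.
Proof. by apply/imsetP => -[i _ /eqP]; rewrite (negPf (neq_lift _ _)). Qed.

Let mem_f (U : {set 'I_n}) (i : 'I_n) : (f i \in f @: U) = (i \in U).
Proof. exact: mem_imset. Qed.

(** Since [ord_max] is never below [f j], only the trace of [A] on the old vertices counts; the fact
    thus serves [f @: U] with and without [ord_max]. *)
Let low_f (A : {set 'I_n.+1}) (U : {set 'I_n}) (j : 'I_n) :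
  (forall i, (f i \in A) = (i \in U)) ->
  #|[set i in A | (i < f j)%N]| = #|[set i in U | (i < j)%N]|.
Proof.
move=> AU; rewrite -(card_imset _ f_inj); apply: eq_card => i.
rewrite !inE; have [k ->|->] := unliftP ord_max i.
  by rewrite mem_f inE AU !lift_max.
rewrite (negPf (max_f _)) lift_max; apply/negbTE.
by rewrite negb_and -leqNgt (ltnW (ltn_ord j)) orbT.
Qed.

Lemma independent_lift (U : {set 'I_n}) :
  independent (string_hypergraph b) (f @: U) =
  independent (string_hypergraph b') U.
Proof.
rewrite !independent_stringE; apply/forall_inP/forall_inP => indU j jU.
  by have := indU (f j); rewrite mem_f (low_f _ (mem_f U)) eq_b; apply.
have /imsetP[k kU ->] := jU.
by rewrite (low_f _ (mem_f U)) -eq_b; apply: indU.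
Qed.

(** A hyperedge through [ord_max] has it as largest element, so such hyperedges exist only if the
    last bit is 1, and then any two elements of [U] complete one. *)
Lemma independent_lift_max (U : {set 'I_n}) :
  independent (string_hypergraph b) (ord_max |: f @: U) =
  independent (string_hypergraph b') U && (tnth b ord_max ==> (#|U| < 2)%N).
Proof.
have mem_fU i : (f i \in ord_max |: f @: U) = (i \in U).
  by rewrite !inE mem_f eq_sym (negPf (neq_lift _ _)).
have lowmax : #|[set i in ord_max |: f @: U | (i < @ord_max n)%N]| = #|U|.
  rewrite -(card_imset _ f_inj); apply: eq_card => i; rewrite !inE.
  have [k ->|->] := unliftP ord_max i.
    by rewrite mem_f eq_sym (negPf (neq_lift _ _)) lift_max ltn_ord andbT.
  by rewrite ltnn andbF (negPf (max_f _)).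
rewrite !independent_stringE; apply/forall_inP/andP => [indU | [/forall_inP indU bmax] j].
  split; last by have := indU ord_max; rewrite setU11 lowmax; apply.
  apply/forall_inP => j jU.
  by have := indU (f j); rewrite mem_fU (low_f _ mem_fU) eq_b; apply.
have [k ->|-> _] := unliftP ord_max j; last by rewrite lowmax.
by rewrite mem_fU (low_f _ mem_fU) -eq_b; apply: indU.
Qed.

Lemma sum_set_last (P : pred {set 'I_n.+1}) :
  \sum_(W | P W) 'X^#|W| =
  \sum_(U : {set 'I_n} | P (f @: U)) 'X^#|U| +
  \sum_(U : {set 'I_n} | P (ord_max |: f @: U)) 'X^(#|U|.+1) :> {poly int}.
Proof.
have f_pre (W : {set 'I_n.+1}) : f @: (f @^-1: W) = W :\ ord_max.
  apply/setP => i; rewrite !inE; have [k ->|->] := unliftP ord_max i.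
    by rewrite mem_f inE eq_sym neq_lift.
  by rewrite eqxx (negPf (max_f _)).
have pre_f (U : {set 'I_n}) : f @^-1: (f @: U) = U by apply/setP => i; rewrite inE mem_f.
have pre_fmax (U : {set 'I_n}) : f @^-1: (ord_max |: f @: U) = U.
  by apply/setP => i; rewrite !inE mem_f eq_sym (negPf (neq_lift _ _)).
rewrite (bigID (fun W : {set 'I_n.+1} => ord_max \in W)) /= addrC; congr (_ + _).
  rewrite (reindex_onto (fun U : {set 'I_n} => f @: U) (fun W => f @^-1: W)) /=.
    apply: eq_big => [U|U _]; last by rewrite card_imset.
    by rewrite max_f pre_f eqxx !andbT.
  move=> W /andP[_ maxW]; rewrite f_pre; apply/setP => i; rewrite !inE.
  by case: eqP => // ->; rewrite (negPf maxW).
rewrite (reindex_onto (fun U : {set 'I_n} => ord_max |: f @: U) (fun W => f @^-1: W)) /=.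
  apply: eq_big => [U|U _]; last by rewrite cardsU1 max_f card_imset.
  by rewrite setU11 pre_fmax eqxx !andbT.
by move=> W /andP[_ maxW]; rewrite f_pre setD1K.
Qed.

(** A last vertex with bit 0 lies in no hyperedge, so it can be freely added to any independent
    set. *)
Lemma indep_poly_last0 : ~~ tnth b ord_max ->
  indep_poly (string_hypergraph b) =
  (1 + 'X) * indep_poly (string_hypergraph b').
Proof.
move=> /negPf b0; rewrite /indep_poly sum_set_last mulrDl mul1r mulr_sumr.
congr (_ + _); first by apply: eq_bigl => U; rewrite independent_lift.
apply: eq_big => [U|U _]; last by rewrite exprS.
by rewrite independent_lift_max b0 andbT.
Qed.

(* For n <= 1 every U has fewer than two elements, so the value of the last bit
   is irrelevant. *)
Lemma indep_poly_last1 : tnth b ord_max || (n <= 1)%N ->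
  indep_poly (string_hypergraph b) =
  indep_poly (string_hypergraph b') + 'X + n%:R *: 'X^2.
Proof.
move=> b1; rewrite /indep_poly sum_set_last -addrA; congr (_ + _).
  by apply: eq_bigl => U; rewrite independent_lift.
have small (U : {set 'I_n}) : independent (string_hypergraph b) (ord_max |: f @: U) = (#|U| < 2)%N.
  rewrite independent_lift_max.
  have -> : (tnth b ord_max ==> (#|U| < 2)%N) = (#|U| < 2)%N.
    case/orP: b1 => [-> //|n1].
    have -> : (#|U| < 2)%N by rewrite ltnS (leq_trans (max_card _)) // card_ord.
    by rewrite implybT.
  (* With fewer than two elements, [U] contains no hyperedge, so its own independence is
     automatic. *)
  rewrite andbC; case: ltnP => //= U2.
  apply/forall_inP => e; rewrite inE => /andP[/eqP e3 _].
  by apply/negP => /subset_leq_card; rewrite e3 leqNgt ltnS (ltnW U2).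
(* The empty set contributes ['X], and each of the [n] singletons contributes ['X^2]. *)
rewrite (bigID (fun U : {set 'I_n} => #|U| == 0%N)) /=; congr (_ + _).
  rewrite (eq_bigl (pred1 set0)) ?big_pred1_eq ?cards0 ?expr1 // => U.
  by rewrite small cards_eq0 /=; case: eqP => [->|]; rewrite ?cards0 ?andbF.
rewrite (eq_bigl (fun U : {set 'I_n} => #|U| == 1%N)) => [|U]; last first.
  by rewrite small; case: #|U| => [|[|]].
rewrite (eq_bigr (fun=> 'X^2)) => [|U /eqP-> //].
rewrite sumr_const -scaler_nat; congr (_%:R *: _).
rewrite -[RHS]bin1 -[in RHS](card_ord n) -card_draws.
by apply: eq_card => U; rewrite inE.
Qed.

End LastVertex.

(** * Antiregular polynomials and their recurrences *)

(** The string formula is kept for [n <= 2], where no 3-subset exists; this lets the recurrences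
    start at [n = 0]. *)
Definition antiregular_poly (n : nat) (c : bool) : {poly int} :=
  indep_poly (string_hypergraph (antiregular_string n c)).

Lemma string_hypergraph_small (n : nat) (b : n.-tuple bool) :
  (n <= 2)%N -> string_hypergraph b = set0.
Proof.
move=> n2; apply/setP => e; rewrite !inE; apply/negbTE/negP => /andP[/eqP e3 _].
by have := max_card (mem e); rewrite e3 card_ord leqNgt ltnS n2.
Qed.

Lemma antiregularE (n : nat) :
  indep_poly (antiregular n) = antiregular_poly n true.
Proof.
rewrite /antiregular /antiregular_poly.
by case: leqP => // n2; rewrite string_hypergraph_small.
Qed.

Lemma antiregular_barE (n : nat) :
  indep_poly (antiregular_bar n) = antiregular_poly n false.
Proof.
rewrite /antiregular_bar /antiregular_poly.
by case: leqP => // n2; rewrite string_hypergraph_small.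
Qed.

(** The alternation is counted from the end of the string, so dropping the last bit shifts the
    parity and complements [c]. *)
Lemma antiregular_string_lift (n : nat) (c : bool) (i : 'I_n) :
  tnth (antiregular_string n (~~ c)) i =
  tnth (antiregular_string n.+1 c) (lift ord_max i).
Proof.
rewrite !tnth_mktuple lift_max /=; congr (_ && _).
by case: n i => [[]//|n] i; rewrite subSn /= ?addbN ?addNb // -ltnS.
Qed.

Lemma antiregular_poly0 (c : bool) : antiregular_poly 0 c = 1.
Proof.
rewrite /antiregular_poly string_hypergraph_small // /indep_poly.
rewrite (eq_bigl (pred1 set0)) ?big_pred1_eq ?cards0 // => W.
have -> : W = set0 by apply/setP => -[].
by rewrite /= eqxx; apply/forall_inP => e; rewrite inE.
Qed.

Lemma antiregular_polyS_false (n : nat) :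
  antiregular_poly n.+1 false = (1 + 'X) * antiregular_poly n true.
Proof.
apply: indep_poly_last0; first exact: (@antiregular_string_lift n false).
by rewrite tnth_mktuple /= subnn andbF.
Qed.

Lemma antiregular_polyS_true (n : nat) :
  antiregular_poly n.+1 true = antiregular_poly n false + 'X + n%:R *: 'X^2.
Proof.
apply: indep_poly_last1; first exact: (@antiregular_string_lift n true).
(* The last bit is 1 only for [n >= 2]; smaller [n] fall under the second alternative. *)
by rewrite tnth_mktuple /= subnn andbT; case: leqP.
Qed.

(** * Coefficient recurrence and closed forms *)

Lemma coef_1X_mul (p : {poly int}) (i : nat) :
  ((1 + 'X) * p)`_i = p`_i + (if i is j.+1 then p`_j else 0).
Proof. by rewrite mulrDl mul1r coefD coefXM; case: i. Qed.

Lemma coef_antiregularSS (n i : nat) :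
  (antiregular_poly n.+2 true)`_i =
  (antiregular_poly n true)`_i +
  (if i is j.+1 then (antiregular_poly n true)`_j else 0) +
  (i == 1%N)%:R + n.+1%:R * (i == 2%N)%:R.
Proof.
rewrite antiregular_polyS_true antiregular_polyS_false.
by rewrite !coefD coef_1X_mul coefZ coefX coefXn.
Qed.

(** The recurrence advances the length by two, so the length is split into its parity [b] and its
    half [m], with induction on [m]. The factors 6 clear denominators. *)
Lemma coef_antiregular_closed (b : bool) (m : nat) :
  let a i := (antiregular_poly (b + m.*2) true)`_i in
  let x := m%:R in let y := b%:R in
  [/\ a 0%N = 1, a 1%N = 2 * x + y, a 2%N = x * (2 * x - 1 + 2 * y),
   6 * a 3%N = x * (x - 1) * (4 * x - 5 + 6 * y) &
   6 * a 4%N = x * (x - 1) * (x - 2) * (x - 2 + 2 * y)].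
Proof.
elim: m => [|m [a0 a1 a2 a3 a4]] /=.
  case: b; last by rewrite antiregular_poly0 !coef1.
  rewrite antiregular_polyS_true antiregular_poly0 scale0r addr0.
  by rewrite !coefD !coefX !coef1.
have -> : (b + m.+1.*2)%N = (b + m.*2).+2 by rewrite doubleS !addnS.
rewrite !coef_antiregularSS /= !mulr0 !addr0 mulr1.
have -> : (b + m.*2).+1%:R = 2 * m%:R + b%:R + 1 :> int by lia.
have -> : m.+1%:R = m%:R + 1 :> int by lia.
have b01 : b%:R = 0 :> int \/ b%:R = 1 :> int by case: (b); [right|left].
move: (m%:R : int) (b%:R : int) b01 a0 a1 a2 a3 a4.
move=> x y b01 a0 a1 a2 a3 a4; rewrite !mulrDr a4 a3 a2 a1 a0; split=> //.
all: by case: b01 => ->; ring.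
Qed.

(** * Log-concavity under multiplication by [1 + 'X] *)

(* The second clause rules out internal zeros. *)
Definition strong_log_concave (p : {poly int}) : Prop :=
  [/\ forall i, 0 <= p`_i, forall i, p`_i = 0 -> p`_i.+1 = 0 &
      forall i, p`_i * p`_i.+2 <= p`_i.+1 ^+ 2].

Lemma strong_log_concaveW (p : {poly int}) :
  strong_log_concave p -> log_concave p.
Proof. by case=> _ _ lcp [|i] // _ _; apply: lcp. Qed.

Lemma strong_log_concave_gap (p : {poly int}) (i : nat) :
  strong_log_concave p -> p`_i * p`_i.+3 <= p`_i.+1 * p`_i.+2.
Proof.
case=> p0 zp lcp.
have [/zp/zp ->|nz1] := eqVneq p`_i.+1 0; first by rewrite mulr0 mulr_ge0.
have [/zp ->|nz2] := eqVneq p`_i.+2 0; first by rewrite mulr0 mulr_ge0.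
have gt1 : 0 < p`_i.+1 by rewrite lt_def nz1 p0.
have gt2 : 0 < p`_i.+2 by rewrite lt_def nz2 p0.
rewrite -(ler_pM2r (mulr_gt0 gt1 gt2)).
have := ler_pM (mulr_ge0 (p0 i) (p0 i.+2)) (mulr_ge0 (p0 i.+1) (p0 i.+3)) (lcp i) (lcp i.+1).
by congr (_ <= _); ring.
Qed.

(** Away from the boundary, the defect of the product is the sum of two consecutive defects of [p]
    and the defect of the gap inequality. *)
Lemma strong_log_concave_1X_mul (p : {poly int}) :
  strong_log_concave p -> strong_log_concave ((1 + 'X) * p).
Proof.
move=> slcp; have [p0 zp lcp] := slcp.
split=> i; rewrite !coef_1X_mul.
- by case: i => [|i]; rewrite ?addr0 ?addr_ge0.
- case: i => [|i] pi.
    by rewrite addr0 in pi; rewrite pi (zp _ pi).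
  by have := p0 i.+1; have := p0 i; have := zp i.+1; lia.
- case: i => [|i].
    have := mulr_ge0 (p0 0%N) (p0 1%N); have := sqr_ge0 p`_0.
    by have := lcp 0%N; rewrite /= addr0; lia.
  have := strong_log_concave_gap i slcp; have := lcp i; have := lcp i.+1.
  by rewrite /=; lia.
Qed.

(** * Log-concavity of the antiregular polynomials *)

Lemma strong_log_concave_antiregular (n : nat) :
  strong_log_concave (antiregular_poly n true).
Proof.
elim/ltn_ind: n => -[|[|n]] IH.
- by rewrite antiregular_poly0; split=> -[|i]; rewrite !coef1.
- rewrite antiregular_polyS_true antiregular_poly0 scale0r addr0.
  by split=> -[|[|i]]; rewrite !coefD !coefX !coef1.
have slc := IH n (leqnSn _).
have [q0 zq lcq] := strong_log_concave_1X_mul slc.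
set q := antiregular_poly _ _.
have q_high i : q`_i.+3 = ((1 + 'X) * antiregular_poly n true)`_i.+3.
  by rewrite coef_antiregularSS coef_1X_mul /= mulr0 !addr0.
pose m := (n.+2)./2; pose b := odd n.+2.
have := coef_antiregular_closed b m; rewrite odd_double_half -/q /=.
have : 1 <= m%:R :> int by rewrite ler1n.
have b01 : b%:R = 0 :> int \/ b%:R = 1 :> int by case: (b); [right|left].
move: (m%:R : int) (b%:R : int) b01 => x y b01 x1 [a0 a1 a2 a3 a4].
(* Positivity in degrees 1 and 2 excludes zeros where the correction term acts. *)
have q2 : 0 < q`_2 by case: b01 => yE; rewrite a2 yE; nia.
have q1 : 0 < q`_1 by case: b01 => yE; rewrite a1 yE; nia.
split.
- by case=> [|[|[|i]]]; rewrite ?a0 ?(ltW q1) ?(ltW q2) // q_high.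
- case=> [|[|[|i]]]; rewrite ?a0 //; first by lia.
  - by lia.
  by rewrite !q_high; apply: zq.
(* The index is that of the leftmost coefficient, so the three remaining cases are centred at
   degrees 1, 2 and 3. *)
- case=> [|[|[|i]]]; last by rewrite !q_high; apply: lcq.
  + rewrite a0 a1 a2 mul1r -subr_ge0.
    have -> : (2 * x + y) ^+ 2 - x * (2 * x - 1 + 2 * y) =
              2 * x * (x + y) + x + y ^+ 2 by ring.
    by rewrite !addr_ge0 ?mulr_ge0 ?sqr_ge0 //; lia.
  + have : 6 * (q`_1 * q`_3) <= 6 * q`_2 ^+ 2; last by lia.
    (* For even length, the shift [z = x - 1] makes all coefficients of the difference
       nonnegative. *)
    have [z z0 xz] : exists2 z, 0 <= z & x = z + 1 by exists (x - 1); lia.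
    rewrite mulrCA a3 a1 a2 -subr_ge0; case: b01 => ->.
      have -> : 6 * (x * (2 * x - 1 + 2 * 0)) ^+ 2 -
                (2 * x + 0) * (x * (x - 1) * (4 * x - 5 + 6 * 0)) =
                2 * x ^+ 2 * (8 * z ^+ 2 + 13 * z + 3) by rewrite xz; ring.
      by rewrite !(mulr_ge0, addr_ge0) ?sqr_ge0 //; lia.
    have -> : 6 * (x * (2 * x - 1 + 2 * 1)) ^+ 2 -
              (2 * x + 1) * (x * (x - 1) * (4 * x - 5 + 6 * 1)) =
              x * (2 * x + 1) * (8 * x ^+ 2 + 9 * x + 1) by ring.
    by rewrite !(mulr_ge0, addr_ge0) ?sqr_ge0 //; lia.
  + have : 36 * (q`_2 * q`_4) <= 36 * q`_3 ^+ 2; last by lia.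
    have -> : 36 * (q`_2 * q`_4) = 6 * q`_2 * (6 * q`_4) by ring.
    have -> : 36 * q`_3 ^+ 2 = (6 * q`_3) ^+ 2 by ring.
    rewrite a2 a3 a4.
    (* At [x = 1] both sides vanish through the factor [x - 1]; beyond that, [z = x - 2] makes every
       term of the factored difference nonnegative. *)
    have [->|[z z0 xz]] : x = 1 \/ exists2 z, 0 <= z & x = z + 2.
      by case: (ltP x 2) => ?; [left|right; exists (x - 2)]; lia.
    - by rewrite !(subrr, mulr0, mul0r, expr2).
    rewrite -subr_ge0; case: b01 => ->.
      have -> : (x * (x - 1) * (4 * x - 5 + 6 * 0)) ^+ 2 -
                6 * (x * (2 * x - 1 + 2 * 0)) *
                (x * (x - 1) * (x - 2) * (x - 2 + 2 * 0)) =
                x ^+ 2 * (z + 1) * (4 * z ^+ 3 + 22 * z ^+ 2 + 33 * z + 9).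
        by rewrite xz; ring.
      by rewrite !(mulr_ge0, addr_ge0, exprn_ge0) //; lia.
    have -> : (x * (x - 1) * (4 * x - 5 + 6 * 1)) ^+ 2 -
              6 * (x * (2 * x - 1 + 2 * 1)) *
              (x * (x - 1) * (x - 2) * (x - 2 + 2 * 1)) =
              x ^+ 2 * (z + 1) * (4 * x ^+ 3 + 10 * x ^+ 2 + 4 * x + (z + 1)).
      by rewrite xz; ring.
    by rewrite !(mulr_ge0, addr_ge0, exprn_ge0) //; lia.
Qed.

Theorem theorem3p2 (n : nat) (hn : (1 <= n)%N) :
  log_concave (indep_poly (antiregular n)) /\
  log_concave (indep_poly (antiregular_bar n)).
Proof.
rewrite antiregularE antiregular_barE.
split; apply: strong_log_concaveW; first exact: strong_log_concave_antiregular.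
case: n hn => // n _; rewrite antiregular_polyS_false.
exact: strong_log_concave_1X_mul (strong_log_concave_antiregular n).
Qed.
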